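(* Let $\mathcal{A}$ be a free hyperplane arrangement in $\mathbb{K}^l$, and let $J(\mathcal{A})\subseteq S=\mathbb{K}[x_1,\dots,x_l]$ be its Jacobian ideal. Then the Hilbert function of $S/J(\mathcal{A})$ is an increasing function.
   Context: $\mathbb{K}$ is a field of characteristic $0$ and $S=\mathbb{K}[x_1,\dots,x_l]$ has the standard grading. A central hyperplane arrangement is a finite set $\mathcal{A}=\{H_1,\dots,H_n\}$ of hyperplanes in $\mathbb{K}^l$ all containing the origin; for each $i$ fix a linear form $\alpha_i\in S$ with $H_i=\alpha_i^{-1}(0)$, and let $Q(\mathcal{A})=\prod_{i=1}^n\alpha_i$. The Jacobian ideal $J(\mathcal{A})$ is the ideal of $S$ generated by $Q(\mathcal{A})$ and all its partial derivatives. Let $\operatorname{Der}_{\mathbb{K}^l}=\{\sum_{i=1}^l f_i\partial_{x_i}\mid f_i\in S\}$ and $D(\mathcal{A})=\{\delta\in\operatorname{Der}_{\mathbb{K}^l}\mid \delta(\alpha_i)\in\alpha_iS\ \text{for all } i\}$. A central arrangement $\mathcal{A}$ is free if $D(\mathcal{A})$ is a free $S$-module. The Hilbert function of $S/J(\mathcal{A})$ is $i\mapsto\dim_{\mathbb{K}}(S/J(\mathcal{A}))_i$; ''increasing'' is meant in the weak sense, i.e. $\dim_{\mathbb{K}}(S/J(\mathcal{A}))_i\le\dim_{\mathbb{K}}(S/J(\mathcal{A}))_{i+1}$ for all $i\ge0$.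
   Formalization: Arrangements of two or more lines in K^2 (l = 2, n ≥ 2) are excluded, since there the claim is false: they are free, but e.g. Q = xy gives J = (x,y) with Hilbert function 1, 0, 0, …, which is not increasing. *)

(* Defs.v *)
From mathcomp Require Import all_boot all_order all_algebra.
From mathcomp Require Export mpoly.
From Stdlib Require Import ClassicalEpsilon.

Set Implicit Arguments.
Unset Strict Implicit.
Unset Printing Implicit Defensive.

Import GRing.Theory.
Local Open Scope ring_scope.

(* The submodule {v | N v} of M is free: it has a basis B, a possibly infinite
   set of elements of N.  Linear combinations are taken over duplicate-free
   lists of elements of B. *)
Definition free_submodule (R : nzRingType) (M : lmodType R) (N : M -> Prop) :
    Prop :=
  exists B : M -> Prop,
    [/\ forall v, B v -> N v,
        forall (s : seq M) (c : M -> R), uniq s ->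
          (forall v, v \in s -> B v) ->
          \sum_(v <- s) c v *: v = 0 -> forall v, v \in s -> c v = 0
      & forall v, N v -> exists (s : seq M) (c : M -> R),
          [/\ uniq s, forall w, w \in s -> B w & v = \sum_(w <- s) c w *: w]].

Definition ideal_gen (R : comNzRingType) (g : seq R) (p : R) : Prop :=
  exists c : 'I_(size g) -> R, p = \sum_(i < size g) c i * g`_i.

Section Hilbert.
Variables (K : fieldType) (l : nat).
Implicit Types (I : {mpoly K[l]} -> Prop) (p : {mpoly K[l]}).

(* For a homogeneous ideal I, the component (S/I)_d is the image of the space
   S_d of forms of degree d; it has dimension h when the classes of some h
   forms of degree d are a K-basis of it. *)
Definition quotient_dim I (d h : nat) : Prop :=
  exists b : 'I_h -> {mpoly K[l]},
    [/\ forall i, b i \is d.-homog,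
        forall c : 'I_h -> K, I (\sum_i c i *: b i) -> forall i, c i = 0
      & forall p, p \is d.-homog ->
          exists c : 'I_h -> K, I (p - \sum_i c i *: b i)].

(* Well defined when I is an ideal: see hilbert_functionP and
   quotient_dim_uniq. *)
Definition hilbert_function I (d : nat) : nat :=
  epsilon (inhabits 0%N) (quotient_dim I d).

Lemma ideal_gen0 (g : seq {mpoly K[l]}) : ideal_gen g 0.
Proof. by exists (fun=> 0); rewrite big1 // => i _; rewrite mul0r. Qed.

Lemma ideal_genD (g : seq {mpoly K[l]}) p q :
  ideal_gen g p -> ideal_gen g q -> ideal_gen g (p + q).
Proof.
move=> [c ->] [e ->]; exists (fun i => c i + e i).
by rewrite -big_split; apply: eq_bigr => i _; rewrite mulrDl.
Qed.

Lemma ideal_genM (g : seq {mpoly K[l]}) p q :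
  ideal_gen g q -> ideal_gen g (p * q).
Proof.
move=> [c ->]; exists (fun i => p * c i).
by rewrite mulr_sumr; apply: eq_bigr => i _; rewrite mulrA.
Qed.

Lemma ideal_genZ (g : seq {mpoly K[l]}) (a : K) p :
  ideal_gen g p -> ideal_gen g (a *: p).
Proof. by rewrite -mul_mpolyC; apply: ideal_genM. Qed.

Lemma ideal_gen_sum (g : seq {mpoly K[l]}) (J : finType)
    (F : J -> {mpoly K[l]}) :
  (forall j, ideal_gen g (F j)) -> ideal_gen g (\sum_j F j).
Proof.
move=> gF; elim/big_ind: _ => //; [exact: ideal_gen0 | exact: ideal_genD].
Qed.

Lemma quotient_dim_leq (g : seq {mpoly K[l]}) d h1 h2 :
  quotient_dim (ideal_gen g) d h1 -> quotient_dim (ideal_gen g) d h2 ->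
  (h1 <= h2)%N.
Proof.
move=> [b1 [hom1 free1 _]] [b2 [_ _ span2]].
have /(_ _)/constructive_indefinite_description c_ i := span2 _ (hom1 i).
pose M := \matrix_(i < h1, j < h2) sval (c_ i) j.
suff freeM : row_free M by rewrite -(eqP freeM) rank_leq_col.
apply: inj_row_free => u uM0; apply/rowP => i; rewrite mxE.
apply: (free1 (u 0)).
have -> : \sum_i u 0 i *: b1 i =
    \sum_i u 0 i *: (b1 i - \sum_j sval (c_ i) j *: b2 j).
  under [RHS]eq_bigr do rewrite scalerBr.
  rewrite sumrB; suff -> : \sum_i u 0 i *: (\sum_j sval (c_ i) j *: b2 j) = 0.
    by rewrite subr0.
  under eq_bigr do rewrite scaler_sumr.
  rewrite exchange_big big1 //= => j _.
  under eq_bigr do rewrite scalerA.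
  rewrite -scaler_suml; move/rowP/(_ j): uM0; rewrite !mxE => uMj.
  apply: etrans (scale0r (b2 j)); congr (_ *: _); rewrite -[RHS]uMj.
  by apply: eq_bigr => k _; rewrite mxE.
by apply: ideal_gen_sum => k; apply: ideal_genZ; case: (c_ k).
Qed.

Lemma quotient_dim_uniq (g : seq {mpoly K[l]}) d h1 h2 :
  quotient_dim (ideal_gen g) d h1 -> quotient_dim (ideal_gen g) d h2 ->
  h1 = h2.
Proof.
by move=> q1 q2; apply/eqP; rewrite eqn_leq !(@quotient_dim_leq g d).
Qed.

Lemma quotient_dim_seq (g : seq {mpoly K[l]}) d (s : seq {mpoly K[l]}) :
  {in s, forall p, p \is d.-homog} ->
  exists h (b : 'I_h -> {mpoly K[l]}),
    [/\ forall i, b i \is d.-homog,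
        forall c : 'I_h -> K, ideal_gen g (\sum_i c i *: b i) ->
          forall i, c i = 0
      & {in s, forall p,
          exists c : 'I_h -> K, ideal_gen g (p - \sum_i c i *: b i)}].
Proof.
elim: s => [|x s IHs] homs.
  by exists 0%N, (fun=> 0); split=> [[]|c _ []|] //.
have [|h [b [homb freeb spanb]]] := IHs.
  by move=> p ps; apply: homs; rewrite inE ps orbT.
have [xb|xNb] := excluded_middle_informative
    (exists c : 'I_h -> K, ideal_gen g (x - \sum_i c i *: b i)).
  exists h, b; split=> // p; rewrite inE => /predU1P[->//|/spanb//].
exists h.+1, (fun i => oapp b x (unlift ord0 i)).
have sumE (c : 'I_h.+1 -> K) :
    \sum_i c i *: oapp b x (unlift ord0 i) =
    c ord0 *: x + \sum_i c (lift ord0 i) *: b i.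
  rewrite big_ord_recl unlift_none /=; congr (_ + _).
  by apply: eq_bigr => i _; rewrite liftK.
split.
- move=> i; case: unliftP => [j _|_] /=; first exact: homb.
  by apply: homs; rewrite mem_head.
- move=> c; rewrite sumE => gc.
  have c0 : c ord0 = 0.
    apply/eqP; apply: contraT => c0; case: xNb.
    exists (fun i => - ((c ord0)^-1 * c (lift ord0 i))).
    have /= := ideal_genZ (c ord0)^-1 gc; rewrite scalerDr scalerA mulVf //.
    rewrite scale1r scaler_sumr; congr (ideal_gen g (_ + _)).
    by rewrite -sumrN; apply: eq_bigr => i _; rewrite scaleNr opprK scalerA.
  rewrite c0 scale0r add0r in gc.
  move=> i; case: (unliftP ord0 i) => [j ->|-> //].
  exact: (freeb (fun i => c (lift ord0 i))).
- move=> p; rewrite inE => /predU1P[->|/spanb[c pc]].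
    exists (fun i => (i == ord0)%:R); rewrite sumE eqxx scale1r.
    by rewrite big1 ?addr0 ?subrr => [|i _]; [exact: ideal_gen0 | rewrite scale0r].
  exists (fun i => oapp c 0 (unlift ord0 i)).
  rewrite sumE unlift_none /= scale0r add0r.
  by under eq_bigr do rewrite liftK.
Qed.

Lemma quotient_dim_exists (g : seq {mpoly K[l]}) d :
  exists h, quotient_dim (ideal_gen g) d h.
Proof.
pose s : seq {mpoly K[l]} :=
  [seq 'X_[val m] | m : 'X_{1..l < d.+1} in [pred m | mdeg (val m) == d]].
have homs : {in s, forall p, p \is d.-homog}.
  by move=> _ /imageP[m md ->]; rewrite dhomogX.
have [h [b [homb freeb spanb]]] := quotient_dim_seq g homs.
exists h, b; split=> // p homp.
have /(_ _)/constructive_indefinite_description c_ (m : 'X_{1..l < d.+1}) :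
    exists c : 'I_h -> K, ideal_gen g (p@_m *: 'X_[m] - \sum_i c i *: b i).
  have [md|md] := eqVneq (mdeg m) d; last first.
    exists (fun=> 0); rewrite (dhomog_nemf_coeff homp md) scale0r.
    by rewrite big1 ?subr0 => [|i _]; [exact: ideal_gen0 | rewrite scale0r].
  have [|c mc] := spanb 'X_[m].
    by apply/imageP; exists m => //; rewrite inE md.
  exists (fun i => p@_m * c i); have := ideal_genZ p@_m mc.
  rewrite scalerBr scaler_sumr; congr (ideal_gen g (_ - _)).
  by apply: eq_bigr => i _; rewrite scalerA.
exists (fun i => \sum_m sval (c_ m) i).
have -> : p - \sum_i (\sum_m sval (c_ m) i) *: b i =
    \sum_(m : 'X_{1..l < d.+1})
      (p@_m *: 'X_[m] - \sum_i sval (c_ m) i *: b i).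
  rewrite sumrB; congr (_ - _).
    apply: mpolywE; rewrite msizeE; apply/bigmax_leqP_seq => m mp _.
    by rewrite (dhomog_mf homp mp).
  under eq_bigr do rewrite scaler_suml.
  by rewrite exchange_big.
by apply: ideal_gen_sum => m; case: (c_ m).
Qed.

Lemma hilbert_functionP (g : seq {mpoly K[l]}) d :
  quotient_dim (ideal_gen g) d (hilbert_function (ideal_gen g) d).
Proof. by apply: epsilon_spec; apply: quotient_dim_exists. Qed.

End Hilbert.

Section Arrangements.
Variables (K : fieldType) (l n : nat).

(* {H_1, ..., H_n} is given by an injective indexing of its n hyperplanes. *)
Definition central_arrangement (H : 'I_n -> {vspace 'rV[K]_l}) : Prop :=
  injective H /\ forall i, (\dim (H i)).+1 = l.

Definition defining_form (H : {vspace 'rV[K]_l}) (a : {mpoly K[l]}) : Prop :=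
  a \is 1.-homog /\
  forall v : 'rV[K]_l, v \in H <-> a.@[fun j => v 0 j] = 0.

Definition defining_poly (alpha : 'I_n -> {mpoly K[l]}) : {mpoly K[l]} :=
  \prod_i alpha i.

Definition jacobian_ideal (alpha : 'I_n -> {mpoly K[l]}) :
    {mpoly K[l]} -> Prop :=
  let Q := defining_poly alpha in
  ideal_gen (Q :: [seq Q^`M(j) | j <- enum 'I_l]).

(* The row vector f stands for the derivation \sum_j f_j * d/dx_j. *)
Definition der_apply (f : 'rV[{mpoly K[l]}]_l) (p : {mpoly K[l]}) :
    {mpoly K[l]} :=
  \sum_j f 0 j * p^`M(j).

Definition log_derivation (alpha : 'I_n -> {mpoly K[l]})
    (f : 'rV[{mpoly K[l]}]_l) : Prop :=
  forall i, exists q, der_apply f (alpha i) = alpha i * q.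

Definition free_arrangement (alpha : 'I_n -> {mpoly K[l]}) : Prop :=
  free_submodule (log_derivation alpha).

End Arrangements.

(* Main.v *)
Require Import Defs.
From mathcomp Require Import all_boot all_order all_algebra.
From mathcomp Require Import ring zify.
From Stdlib Require ClassicalEpsilon.

(** Let Q be the product of the n forms alpha_i and J its Jacobian ideal.  If
    n <= 1 then J contains 1 and the Hilbert function vanishes; this covers
    l <= 2.  Otherwise l >= 3 and n >= 2, and there is a linear form a which is
    a nonzerodivisor on S/J: multiplication by a then embeds (S/J)_i in
    (S/J)_(i+1).

    The form a is generic: the images of the alpha_i in S/(a) are nonzero and
    pairwise coprime.  It exists because K is infinite and any two of the
    hyperplanes meet in a nonzero vector, so that a only has to be nonzero at
    finitely many nonzero vectors ([generic_form]).  The ring S/(a) is not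
    formed; an endomorphism phi of S with kernel (a) and p = phi p modulo a
    plays its role ([linear_form_residue]).

    Suppose that a p is in J.  By Euler's formula a p = f(Q) for a derivation f.
    Expanding f(Q) by the Leibniz rule modulo a, where alpha_i is prime and
    divides no other alpha_k, shows that alpha_i divides f(alpha_i) modulo a
    ([log_modulo]).  Freeness then gives that f is congruent modulo a to some
    theta in D = D(A) ([log_modulo_lift]).  Indeed, f minus a multiple of a
    constant derivation kills alpha_i, hence Q f lies in
    alpha_i D + f(alpha_i) D, for each i ([log_derivation_decomp]).  So every
    coordinate of Q f in a basis of D is divisible by each alpha_i modulo a,
    and therefore by Q: one gets Q f = Q theta + a delta with theta, delta in D,
    and a divides f - theta since it is prime to Q.  Write f = theta + a g and
    theta(Q) = Q h.  Then a divides Q h, thus h = a h', and p = h' Q + g(Q) lies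
    in J ([nonzerodivisor_mod_jacobian]).

    The argument is the exactness, modulo a, of the Hilbert-Burch resolution of
    S/J, but it needs neither gradings on D nor the rank of D. *)

Set Implicit Arguments.
Unset Strict Implicit.
Unset Printing Implicit Defensive.

Import GRing.Theory.
Local Open Scope ring_scope.

(** * Divisibility and residue maps *)

(** [a] divides [p]. *)
Definition divides (R : comNzRingType) (a p : R) : Prop := exists q, p = a * q.

(** The residue map of the quotient by [a], realized inside the ring itself:
    an endomorphism [phi] with kernel the ideal of [a] that chooses a
    representative [phi p] of the class of each [p]. *)
Definition residue_map (R : comNzRingType) (a : R) (phi : {rmorphism R -> R}) :
    Prop :=
  phi a = 0 /\ forall p, divides a (p - phi p).

(** Prime elements; zero is one of them in an integral domain. *)
Definition prime_elt (R : comNzRingType) (a : R) : Prop :=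
  ~ divides a 1 /\ forall p q, divides a (p * q) -> divides a p \/ divides a q.

Section Divisibility.
Variable R : comNzRingType.
Implicit Types (a p q : R) (phi : {rmorphism R -> R}).

Lemma dividesD a p q : divides a p -> divides a q -> divides a (p + q).
Proof. by move=> [u ->] [v ->]; exists (u + v); rewrite mulrDr. Qed.

Lemma dividesMr a p q : divides a p -> divides a (p * q).
Proof. by move=> [u ->]; exists (u * q); rewrite mulrA. Qed.

Lemma dividesMl a p q : divides a q -> divides a (p * q).
Proof. by rewrite mulrC; apply: dividesMr. Qed.

Lemma divides_sum a (I : finType) (P : pred I) (F : I -> R) :
  (forall i, P i -> divides a (F i)) -> divides a (\sum_(i | P i) F i).
Proof.
move=> aF; elim/big_ind: _ => //; last exact: dividesD.
by exists 0; rewrite mulr0.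
Qed.

Lemma divides_prod_factor (I : finType) (P : pred I) (F : I -> R) j :
  P j -> divides (F j) (\prod_(i | P i) F i).
Proof. by move=> Pj; rewrite (bigD1 j) //=; eexists. Qed.

Lemma residue_eq0 a phi p : residue_map a phi -> phi p = 0 <-> divides a p.
Proof.
move=> [phia0 phiE]; split=> [phip0|[q ->]].
  by have := phiE p; rewrite phip0 subr0.
by rewrite rmorphM phia0 mul0r.
Qed.

(** Divisibility in the quotient by [a], read through representatives. *)
Lemma residue_divides_lift a phi b p : residue_map a phi ->
  divides (phi b) (phi p) <-> exists u v, p = b * u + a * v.
Proof.
move=> phiP; split=> [[q pq]|[u [v ->]]].
  have [[x px] [y bY]] := (phiP.2 p, phiP.2 b).
  exists q, (x - y * q).
  rewrite -[p in LHS](subrK (phi p)) px pq -[in LHS](subKr b (phi b)) bY.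
  by ring.
by exists (phi u); rewrite rmorphD !rmorphM phiP.1 mul0r addr0.
Qed.

Lemma prime_prod_ndivides a (I : Type) (r : seq I) (P : pred I) (F : I -> R) :
  prime_elt a -> (forall i, P i -> ~ divides a (F i)) ->
  ~ divides a (\prod_(i <- r | P i) F i).
Proof.
move=> [aN1 a_prime] aNF; elim/big_ind: _ => // x y aNx aNy.
by case/a_prime.
Qed.

(** A common multiple of pairwise non-associate primes is a multiple of their
    product. *)
Lemma divides_prod_primes (I : finType) (F : I -> R) p :
  (forall i, prime_elt (F i)) ->
  (forall i k, i != k -> ~ divides (F i) (F k)) ->
  (forall i, divides (F i) p) -> divides (\prod_i F i) p.
Proof.
move=> F_prime F_coprime Fp; rewrite -big_enum /=.
elim: (enum I) (enum_uniq I) => [|i r IHr] /=.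
  by exists p; rewrite big_nil mul1r.
case/andP=> iNr /IHr[q pE]; have := Fp i; rewrite pE.
case/(F_prime i).2 => [|[u ->]]; last first.
  by exists u; rewrite big_cons mulrCA mulrA.
rewrite big_seq_cond => /prime_prod_ndivides[] // k /andP[kr _].
by apply: F_coprime; apply: contraNneq iNr => ->.
Qed.

End Divisibility.

Lemma residue_prime (R : idomainType) (a : R) (phi : {rmorphism R -> R}) :
  residue_map a phi -> prime_elt a.
Proof.
move=> phiP; split=> [|p q].
  by move/(residue_eq0 _ phiP)/eqP; rewrite rmorph1 oner_eq0.
move/(residue_eq0 _ phiP)/eqP; rewrite rmorphM mulf_eq0.
by case/orP=> /eqP; rewrite (residue_eq0 _ phiP); [left | right].
Qed.

(** * Linear forms *)

Section LinearForms.
Variables (K : fieldType) (l : nat).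
Implicit Types (a p : {mpoly K[l]}).

Lemma linear_formE p : p \is 1.-homog -> p = \sum_j p@_U_(j) *: 'X_j.
Proof.
move=> homp; apply/mpolyP=> m; rewrite raddf_sum /=.
have [/mdeg1P[j /eqP mE]|md] := boolP (mdeg m == 1%N).
  subst m; rewrite (bigD1 j) //= big1 => [|k kj].
    by rewrite mcoeffZ mcoeffX eqxx mulr1 addr0.
  by rewrite mcoeffZ mcoeffX eq_mnm1 (negPf kj) mulr0.
rewrite (dhomog_nemf_coeff homp md) big1 // => j _.
rewrite mcoeffZ mcoeffX; case: eqP => [mE|]; last by rewrite mulr0.
by rewrite -mE mdeg1 in md.
Qed.

Lemma linear_form_coef_neq0 p : p \is 1.-homog -> p != 0 ->
  exists j, p@_U_(j) != 0.
Proof.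
move=> homp p0; apply/existsP; apply: contraNT p0.
rewrite negb_exists => /forallP p0.
rewrite (linear_formE homp) big1 // => j _.
by move: (p0 j); rewrite negbK => /eqP->; rewrite scale0r.
Qed.

(** Substituting for each variable something congruent to it modulo [a] does
    not change classes modulo [a]. *)
Lemma comp_mpoly_congruence a (t : l.-tuple {mpoly K[l]}) p :
  (forall j, divides a ('X_j - tnth t j)) -> divides a (p - (p \mPo t)).
Proof.
move=> at_; have -> : p - (p \mPo t) = \sum_(m <- msupp p)
    (p@_m *: 'X_[m] - p@_m *: \prod_(i < l) tnth t i ^+ m i).
  by rewrite comp_mpolyE sumrB; congr (_ - _); apply: mpolyE.
elim/big_ind: _ => [||m _]; first by exists 0; rewrite mulr0.
  by move=> x y; exact: dividesD.
rewrite -scalerBr -mul_mpolyC; apply: dividesMl.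
rewrite mpolyXE_id; elim/big_ind2: _ => [|y1 x1 y2 x2 ax ay|j _].
- by exists 0; rewrite subrr mulr0.
- have -> : x1 * x2 - y1 * y2 = x1 * (x2 - y2) + (x1 - y1) * y2 by ring.
  by apply: dividesD; [apply: dividesMl | apply: dividesMr].
- by rewrite subrXX; apply: dividesMr.
Qed.

(** The quotient by a nonzero linear form [a] is realized by eliminating a
    variable that occurs in [a]. *)
Lemma linear_form_residue a : a \is 1.-homog -> a != 0 ->
  exists2 phi : {rmorphism {mpoly K[l]} -> {mpoly K[l]}}, residue_map a phi &
    forall p, p \is 1.-homog -> phi p \is 1.-homog.
Proof.
move=> homa a0.
have [j aj0] := linear_form_coef_neq0 homa a0.
pose e i := if i == j then (a@_U_(j))^-1 else 0.
pose t := [tuple ('X_i : {mpoly K[l]}) - e i *: a | i < l].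
have homt i : tnth t i \is 1.-homog.
  rewrite tnth_mktuple; apply: rpredB; last exact: rpredZ.
  by rewrite dhomogX /= mdeg1.
have compE p : p \is 1.-homog -> p \mPo t = \sum_j p@_U_(j) *: tnth t j.
  move=> homp; rewrite {1}(linear_formE homp) raddf_sum /=.
  apply: eq_bigr => i _; by rewrite comp_mpolyZ comp_mpolyXU -tnth_nth.
exists (comp_mpoly t) => [|p homp]; last first.
  by rewrite /= compE //; apply: rpred_sum => i _; apply: rpredZ.
split=> [|p] /=.
  rewrite compE //; under eq_bigr do rewrite tnth_mktuple scalerBr.
  rewrite sumrB -linear_formE // (bigD1 j) //= big1 => [|i /negPf ij].
    by rewrite /e eqxx scalerA divff // scale1r addr0 subrr.
  by rewrite /e ij scale0r scaler0.
apply: comp_mpoly_congruence => i; rewrite tnth_mktuple opprB addrC subrK.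
by exists (e i)%:MP; rewrite mulrC mul_mpolyC.
Qed.

End LinearForms.

(** * Coordinates in a free module *)

Section FreeCoordinates.
Variables (R : nzRingType) (M : lmodType R).

(** Linear independence of a possibly infinite set [B], tested on
    duplicate-free lists of elements of [B]. *)
Definition independent_set (B : M -> Prop) : Prop :=
  forall (s : seq M) (c : M -> R), uniq s ->
    (forall v, v \in s -> B v) ->
    \sum_(v <- s) c v *: v = 0 -> forall v, v \in s -> c v = 0.

Lemma sum_enlarge (s u : seq M) (c : M -> R) :
  uniq s -> uniq u -> {subset s <= u} ->
  \sum_(w <- s) c w *: w = \sum_(w <- u) (if w \in s then c w else 0) *: w.
Proof.
move=> uniq_s uniq_u su.
transitivity (\sum_(w <- u | w \in s) c w *: w).
  rewrite -[RHS]big_filter; apply: perm_big.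
  apply: uniq_perm; rewrite ?filter_uniq // => w.
  by rewrite mem_filter; case: (boolP (w \in s)) => // /su ->.
rewrite big_mkcond; apply: eq_bigr => w _.
by case: ifP => // _; rewrite scale0r.
Qed.

(** If [v0 = x *: v1 + y *: v2] in a free module, each coordinate of [v0]
    has the form [x * d' + y * e'].  The three vectors may be expanded along
    different finite parts of the basis. *)
Lemma coordinates_of_comb (B : M -> Prop) (s s1 s2 : seq M) (c d e : M -> R)
    (x y : R) :
  independent_set B ->
  uniq s -> (forall v, v \in s -> B v) ->
  uniq s1 -> (forall v, v \in s1 -> B v) ->
  uniq s2 -> (forall v, v \in s2 -> B v) ->
  \sum_(w <- s) c w *: w =
    x *: (\sum_(w <- s1) d w *: w) + y *: (\sum_(w <- s2) e w *: w) ->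
  forall w, w \in s -> exists d' e', c w = x * d' + y * e'.
Proof.
move=> indepB uniq_s sB uniq_s1 s1B uniq_s2 s2B sumE w ws.
pose u := undup (s ++ s1 ++ s2).
have uE v : (v \in u) = [|| v \in s, v \in s1 | v \in s2].
  by rewrite mem_undup !mem_cat.
pose r (t : seq M) (a : M -> R) v := if v \in t then a v else 0.
have /eqP : r s c w - (x * r s1 d w + y * r s2 e w) = 0.
  apply: (indepB u (fun v => r s c v - (x * r s1 d v + y * r s2 e v))).
  - exact: undup_uniq.
  - by move=> v; rewrite uE => /or3P[/sB|/s1B|/s2B].
  - under eq_bigr do rewrite scalerBl scalerDl -!scalerA.
    rewrite sumrB big_split /= -!scaler_sumr.
    rewrite -!sum_enlarge ?undup_uniq ?sumE ?subrr // => v vt; rewrite uE vt.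
    + by rewrite !orbT.
    + by rewrite orbT.
    + by [].
  - by rewrite uE ws.
rewrite subr_eq0 => /eqP; rewrite {1}/r ws => ->.
by exists (r s1 d w), (r s2 e w).
Qed.

End FreeCoordinates.

(** * Derivations of the polynomial ring *)

Section Derivations.
Variables (K : fieldType) (l : nat).
Implicit Types (f g : 'rV[{mpoly K[l]}]_l) (p q : {mpoly K[l]}).

Lemma der_applyDl f g p : der_apply (f + g) p = der_apply f p + der_apply g p.
Proof.
by rewrite -big_split; apply: eq_bigr => j _; rewrite mxE mulrDl.
Qed.

Lemma der_applyZl q f p : der_apply (q *: f) p = q * der_apply f p.
Proof. by rewrite mulr_sumr; apply: eq_bigr => j _; rewrite mxE mulrA. Qed.

Lemma der_apply_delta j p : der_apply (delta_mx 0 j) p = p^`M(j).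
Proof.
rewrite /der_apply (bigD1 j) //= big1 => [|k /negPf kj].
  by rewrite mxE !eqxx mul1r addr0.
by rewrite mxE kj andbF mul0r.
Qed.

Lemma der_applyM f p q :
  der_apply f (p * q) = der_apply f p * q + p * der_apply f q.
Proof.
rewrite mulr_suml mulr_sumr -big_split; apply: eq_bigr => j _ /=.
by rewrite mderivM; ring.
Qed.

Lemma der_apply_prod f (I : finType) (F : I -> {mpoly K[l]}) :
  der_apply f (\prod_i F i) = \sum_i der_apply f (F i) * \prod_(k | k != i) F k.
Proof.
suff H r : uniq r -> der_apply f (\prod_(i <- r) F i) =
    \sum_(i <- r) der_apply f (F i) * \prod_(k <- r | k != i) F k.
  rewrite -[in LHS]big_enum /= H ?enum_uniq // big_enum /=.
  by apply: eq_bigr => i _; rewrite big_enum_cond.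
elim: r => [_|i r IHr /= /andP[iNr uniq_r]].
  rewrite !big_nil; apply: big1 => j _.
  by rewrite -[1]/(1%:MP) mderivC mulr0.
rewrite !big_cons eqxx /= der_applyM IHr // mulr_sumr; congr (_ * _ + _).
  rewrite big_seq [RHS]big_seq_cond; apply: eq_bigl => k.
  by case: (boolP (k \in r)) => //= kr; apply/esym; apply: contraNneq iNr => <-.
rewrite big_seq [RHS]big_seq; apply: eq_bigr => j jr.
have ij : i != j by apply: contraNneq iNr => ->.
by rewrite big_cons ij mulrCA.
Qed.

Lemma mderiv_linear p j : p \is 1.-homog -> p^`M(j) = (p@_U_(j))%:MP.
Proof.
move=> homp; rewrite {1}(linear_formE homp) raddf_sum (bigD1 j) //=.
rewrite big1 => [|k kj]; rewrite mderivZ mderivX mnm1E.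
  have -> : (U_(j) - U_(j) = 0)%MM by apply/mnmP=> k; rewrite mnmBE subnn mnm0E.
  by rewrite eqxx scale1r addr0 mpolyX0 -mul_mpolyC mulr1.
by rewrite (negPf kj) scale0r scaler0.
Qed.

(** The Euler derivation fixes linear forms. *)
Lemma euler_linear p : p \is 1.-homog -> der_apply (\row_j 'X_j) p = p.
Proof.
move=> homp; rewrite [RHS](linear_formE homp); apply: eq_bigr => j _.
by rewrite mxE mderiv_linear // mulrC mul_mpolyC.
Qed.

End Derivations.

(** * Logarithmic derivations and the Jacobian ideal *)

Lemma ideal_gen_mem (K : fieldType) (l : nat) (g : seq {mpoly K[l]}) p :
  p \in g -> ideal_gen g p.
Proof.
move=> pg; have ig : (index p g < size g)%N by rewrite index_mem.
exists (fun i => (i == Ordinal ig)%:R).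
rewrite (bigD1 (Ordinal ig)) //= eqxx mul1r nth_index // big1 ?addr0 // => i.
by move/negPf->; rewrite mul0r.
Qed.

Section LogDerivations.
Variables (K : fieldType) (l n : nat) (alpha : 'I_n -> {mpoly K[l]}).
Hypothesis homalpha : forall i, alpha i \is 1.-homog.

Local Notation Q := (defining_poly alpha).
Local Notation D := (log_derivation alpha).

Lemma log_derivation_defining_poly f : D f -> divides Q (der_apply f Q).
Proof.
move=> Df; rewrite der_apply_prod; apply: divides_sum => i _.
have [q ->] := Df i.
by exists q; rewrite /defining_poly [in RHS](bigD1 i) //= mulrAC.
Qed.

Lemma log_derivationD f g : D f -> D g -> D (f + g).
Proof.
by move=> Df Dg i; rewrite der_applyDl; apply: dividesD; [apply: Df|apply: Dg].
Qed.

Lemma log_derivationZ q f : D f -> D (q *: f).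
Proof. by move=> Df i; rewrite der_applyZl; apply: dividesMl; apply: Df. Qed.

Lemma log_derivation_sum (I : eqType) (r : seq I)
    (F : I -> 'rV[{mpoly K[l]}]_l) :
  (forall i, i \in r -> D (F i)) -> D (\sum_(i <- r) F i).
Proof.
move=> DF; rewrite big_seq; elim/big_ind: _ => //.
  by move=> i; exists 0; rewrite /der_apply big1 ?mulr0 // => j _;
    rewrite mxE mul0r.
exact: log_derivationD.
Qed.

Lemma log_derivation_scaled f : D (Q *: f).
Proof.
move=> i; rewrite der_applyZl; apply: dividesMr.
exact: (divides_prod_factor (P := predT)).
Qed.

(** With [e] a multiple of a coordinate derivation such that
    [e (alpha i) = 1], the derivation [f - f(alpha i) e] kills [alpha i], so
    that multiplying it by the product of the other forms makes it
    logarithmic. *)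
Lemma log_derivation_decomp i f : alpha i != 0 ->
  exists v1 v2, [/\ D v1, D v2 &
    Q *: f = alpha i *: v1 + der_apply f (alpha i) *: v2].
Proof.
move=> ai0.
have [j aj0] := linear_form_coef_neq0 (homalpha i) ai0.
have [e ae] : exists e, der_apply e (alpha i) = 1.
  exists ((((alpha i)@_U_(j))^-1)%:MP *: delta_mx 0 j).
  by rewrite der_applyZl der_apply_delta mderiv_linear // -mpolyCM mulVf.
pose Qi := \prod_(k | k != i) alpha k.
have QE : Q = alpha i * Qi by rewrite /defining_poly (bigD1 i).
exists (Qi *: (f - der_apply f (alpha i) *: e)), (Q *: e); split.
- move=> k; rewrite der_applyZl; have [->|ki] := eqVneq k i.
    rewrite -scaleN1r der_applyDl !der_applyZl ae.
    by exists 0; ring.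
  by apply: dividesMr; apply: divides_prod_factor.
- exact: log_derivation_scaled.
- by rewrite scalerA -QE scalerBr !scalerA [_ * Q]mulrC subrK.
Qed.

Lemma jacobian_idealP p : jacobian_ideal alpha p <->
  exists q f, p = q * Q + der_apply f Q.
Proof.
split=> [[c ->]|[q [f ->]]].
  elim/big_ind: _ => [|x y|i _].
  - by exists 0, 0; rewrite /der_apply big1 => [|j _]; rewrite ?mxE; ring.
  - move=> [q1 [f1 ->]] [q2 [f2 ->]]; exists (q1 + q2), (f1 + f2).
    by rewrite der_applyDl; ring.
  - have := mem_nth 0 (ltn_ord i); rewrite inE => /predU1P[->|/mapP[j _ ->]].
      exists (c i), 0; rewrite /der_apply big1 ?addr0 // => j _.
      by rewrite mxE mul0r.
    exists 0, (c i *: delta_mx 0 j).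
    by rewrite der_applyZl der_apply_delta; ring.
apply: ideal_genD.
  by apply: ideal_genM; apply: ideal_gen_mem; rewrite mem_head.
apply: ideal_gen_sum => j; apply: ideal_genM; apply: ideal_gen_mem.
by rewrite in_cons; apply/orP; right; apply/mapP; exists j; rewrite ?mem_enum.
Qed.

Lemma euler_defining_poly : der_apply (\row_j 'X_j) Q = Q *+ n.
Proof.
rewrite der_apply_prod.
transitivity (\sum_(i < n) Q); last by rewrite sumr_const card_ord.
by apply: eq_bigr => i _; rewrite euler_linear // /defining_poly [RHS](bigD1 i).
Qed.

(** By Euler's formula [Q] itself is superfluous as a generator of the Jacobian
    ideal. *)
Lemma jacobian_ideal_der p : [pchar K] =i pred0 -> (0 < n)%N ->
  jacobian_ideal alpha p -> exists f, p = der_apply f Q.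
Proof.
move=> char0 n_gt0 /jacobian_idealP[q [f ->]].
have n_inv : n%:R^-1 *+ n = 1 :> K.
  by rewrite -[LHS]mulr_natr mulVf // ((pcharf0P _).1 char0) -lt0n.
exists ((q * (n%:R^-1)%:MP) *: \row_j 'X_j + f).
rewrite der_applyDl der_applyZl euler_defining_poly -mulrA; congr (q * _ + _).
by rewrite mulrnAr -mulrnAl -mpolyCMn n_inv mul1r.
Qed.

(** * A generic linear form is a nonzerodivisor modulo the Jacobian ideal *)

Section GenericSection.
Variables (a : {mpoly K[l]}) (phi : {rmorphism {mpoly K[l]} -> {mpoly K[l]}}).
Hypothesis phiP : residue_map a phi.
Hypothesis a0 : a != 0.
Hypothesis phi_alpha_prime : forall i, prime_elt (phi (alpha i)).
Hypothesis phi_alpha_neq0 : forall i, phi (alpha i) != 0.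
Hypothesis phi_alpha_coprime :
  forall i k, i != k -> ~ divides (phi (alpha i)) (phi (alpha k)).

Lemma phi_defining_poly : phi Q = \prod_i phi (alpha i).
Proof. exact: rmorph_prod. Qed.

Lemma phi_defining_poly_neq0 : phi Q != 0.
Proof. by rewrite phi_defining_poly; apply/prodf_neq0. Qed.

Lemma divides_residue_cancel p : divides a (Q * p) -> divides a p.
Proof.
move/(residue_eq0 _ phiP)/eqP; rewrite rmorphM mulf_eq0.
rewrite (negPf phi_defining_poly_neq0) => /eqP.
by rewrite (residue_eq0 _ phiP).
Qed.

(** A derivation [f] with [f(Q)] divisible by [a] is logarithmic modulo [a]. *)
Lemma log_modulo f : divides a (der_apply f Q) ->
  forall i, divides (phi (alpha i)) (phi (der_apply f (alpha i))).
Proof.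
move=> /(residue_eq0 _ phiP); rewrite der_apply_prod rmorph_sum => fQ i.
move: fQ; rewrite (bigD1 i) //= => /eqP; rewrite addr_eq0 rmorphM => /eqP fQ.
(* Every term of the Leibniz expansion but the i-th contains the factor
   phi (alpha i). *)
have : divides (phi (alpha i))
    (phi (der_apply f (alpha i)) * phi (\prod_(k | k != i) alpha k)).
  rewrite fQ -sumrN; apply: divides_sum => k ki.
  rewrite rmorphM rmorph_prod -mulNr; apply: dividesMl.
  by apply: (divides_prod_factor (fun k => phi (alpha k))); rewrite eq_sym.
case/(phi_alpha_prime i).2 => //; rewrite rmorph_prod.
case/prime_prod_ndivides => // k ki.
by apply: phi_alpha_coprime; rewrite eq_sym.
Qed.

(** The key use of freeness: when D(A) is free, a derivation that is
    logarithmic modulo [a] lifts to a logarithmic one. *)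
Lemma log_modulo_lift f : free_arrangement alpha ->
  (forall i, divides (phi (alpha i)) (phi (der_apply f (alpha i)))) ->
  exists theta g, D theta /\ f = theta + a *: g.
Proof.
move=> [B [BD indepB spanB]] flog.
have [s [c [uniq_s sB QfE]]] := spanB _ (log_derivation_scaled f).
(* Each coordinate of Q f in the basis B is a multiple of Q modulo a. *)
have cE w : w \in s -> exists h k, c w = Q * h + a * k.
  move=> ws; apply/(residue_divides_lift _ _ phiP); rewrite phi_defining_poly.
  apply: divides_prod_primes => // i.
  have ai0 : alpha i != 0.
    by apply: contraNneq (phi_alpha_neq0 i) => ->; rewrite rmorph0.
  have [v1 [v2 [Dv1 Dv2 fE]]] := log_derivation_decomp f ai0.
  have [s1 [d [uniq_s1 s1B v1E]]] := spanB _ Dv1.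
  have [s2 [e [uniq_s2 s2B v2E]]] := spanB _ Dv2.
  rewrite QfE v1E v2E in fE.
  have [d' [e' ->]] := coordinates_of_comb indepB uniq_s sB uniq_s1 s1B
    uniq_s2 s2B fE ws.
  rewrite rmorphD !rmorphM; apply: dividesD; apply: dividesMr => //.
  by exists 1; rewrite mulr1.
have [hk hkE] : exists hk : 'rV[{mpoly K[l]}]_l -> {mpoly K[l]} * {mpoly K[l]},
    forall w, w \in s -> c w = Q * (hk w).1 + a * (hk w).2.
  apply: (ClassicalEpsilon.choice
    (fun w (x : {mpoly K[l]} * {mpoly K[l]}) =>
       w \in s -> c w = Q * x.1 + a * x.2)) => w.
  have [ws|wNs] := boolP (w \in s); last by exists 0.
  by have [h [k ->]] := cE w ws; exists (h, k).
pose theta := \sum_(w <- s) (hk w).1 *: w.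
pose delta := \sum_(w <- s) (hk w).2 *: w.
have QfE' : Q *: (f - theta) = a *: delta.
  rewrite scalerBr QfE !scaler_sumr -sumrB big_seq [RHS]big_seq.
  by apply: eq_bigr => w ws; rewrite hkE // scalerDl !scalerA addrC addKr.
have g_ j : divides a ((f - theta) 0 j).
  apply: divides_residue_cancel; exists (delta 0 j).
  by move/rowP/(_ j): QfE'; rewrite !mxE.
have [g gE] := ClassicalEpsilon.choice _ g_.
exists theta, (\row_j g j); split.
  by apply: log_derivation_sum => w ws; apply: log_derivationZ; apply/BD/sB.
by apply/rowP => j; rewrite !mxE -gE !mxE addrC subrK.
Qed.

Lemma nonzerodivisor_mod_jacobian p :
  [pchar K] =i pred0 -> (0 < n)%N -> free_arrangement alpha ->
  jacobian_ideal alpha (a * p) -> jacobian_ideal alpha p.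
Proof.
move=> char0 n_gt0 freeA /(jacobian_ideal_der char0 n_gt0)[f fQ].
have /log_modulo/(log_modulo_lift freeA)[theta [g [Dtheta fE]]] :
  divides a (der_apply f Q) by exists p.
have [h thetaQ] := log_derivation_defining_poly Dtheta.
have gQ : a * (p - der_apply g Q) = Q * h.
  by rewrite mulrBr fQ fE der_applyDl der_applyZl addrK.
have [h' hE] : divides a h.
  by apply: divides_residue_cancel; rewrite -gQ; eexists.
apply/jacobian_idealP; exists h', g.
apply: (mulfI a0); rewrite mulrDr -[LHS](subrK (a * der_apply g Q)).
rewrite -mulrBr gQ hE.
by congr (_ + _); ring.
Qed.

End GenericSection.
End LogDerivations.

(** * Hilbert functions *)

Section HilbertFunction.
Variables (K : fieldType) (l : nat) (g : seq {mpoly K[l]}).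
Local Notation I := (ideal_gen g).

Lemma independent_leq_spanning h1 h2 (v : 'I_h1 -> {mpoly K[l]})
    (b : 'I_h2 -> {mpoly K[l]}) :
  (forall c : 'I_h1 -> K, I (\sum_i c i *: v i) -> forall i, c i = 0) ->
  (forall i, exists c : 'I_h2 -> K, I (v i - \sum_j c j *: b j)) ->
  (h1 <= h2)%N.
Proof.
move=> freev /ClassicalEpsilon.choice[c vE].
pose M := \matrix_(i < h1, j < h2) c i j.
suff /eqP <- : row_free M by apply: rank_leq_col.
apply: inj_row_free => u uM0; apply/rowP => i; rewrite mxE.
apply: (freev (u 0)).
have -> : \sum_i u 0 i *: v i = \sum_i u 0 i *: (v i - \sum_j c i j *: b j).
  under [RHS]eq_bigr do rewrite scalerBr scaler_sumr.
  rewrite sumrB exchange_big /= [X in _ - X]big1 ?subr0 // => j _.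
  under eq_bigr do rewrite scalerA.
  rewrite -scaler_suml; have /rowP/(_ j) := uM0; rewrite !mxE.
  by under eq_bigr do rewrite mxE; move=> ->; rewrite scale0r.
by apply: ideal_gen_sum => k; apply: ideal_genZ.
Qed.

Lemma hilbert_function_nonzerodivisor a d : a \is 1.-homog ->
  (forall p, I (a * p) -> I p) ->
  (hilbert_function I d <= hilbert_function I d.+1)%N.
Proof.
move=> homa aP.
have [b [homb freeb _]] := hilbert_functionP g d.
have [b' [_ _ spanb']] := hilbert_functionP g d.+1.
apply: (@independent_leq_spanning _ _ (fun i => a * b i) b') => [c Ic|i].
  apply: freeb; apply: aP; rewrite mulr_sumr.
  by under eq_bigr do rewrite -scalerAr.
by apply: spanb'; rewrite -add1n dhomogM.
Qed.

Lemma hilbert_function_unit d : I 1 -> hilbert_function I d = 0%N.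
Proof.
move=> I1; have [b [_ freeb _]] := hilbert_functionP g d.
case: (hilbert_function I d) b freeb => // h b freeb.
have /eqP : (1 : K) = 0; last by rewrite oner_eq0.
apply: (freeb (fun=> 1) _ ord0).
by rewrite -[X in I X]mulr1; apply: ideal_genM.
Qed.

End HilbertFunction.

(** * Choice of a generic linear form *)

Lemma nonroot_char0 (K : fieldType) (P : {poly K}) :
  [pchar K] =i pred0 -> P != 0 -> exists t, P.[t] != 0.
Proof.
move=> char0 P0; pose rs : seq K := [seq t%:R | t <- iota 0 (size P)].
have uniq_rs : uniq rs.
  rewrite map_inj_uniq ?iota_uniq // => x y xy.
  wlog le_xy : x y xy / (x <= y)%N.
    by move=> W; case/orP: (leq_total x y) => ?; [|symmetry]; apply: W.
  apply/eqP; rewrite eqn_leq le_xy /= -subn_eq0 -((pcharf0P K).1 char0).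
  by rewrite natrB // xy subrr.
have /allPn[t _ tP] : ~~ all (root P) rs.
  apply/negP=> /(max_poly_roots P0)/(_ uniq_rs).
  by rewrite size_map size_iota ltnn.
by exists t.
Qed.

(** Finitely many nonzero vectors lie off a common hyperplane: a general point
    (1, t, t^2, ...) of the moment curve is the coefficient vector of such a
    hyperplane. *)
Lemma avoid_vectors (K : fieldType) (l : nat) (I : finType)
    (w : I -> 'rV[K]_l) :
  [pchar K] =i pred0 -> (forall i, w i != 0) ->
  exists c : 'rV[K]_l, forall i, \sum_j c 0 j * w i 0 j != 0.
Proof.
move=> char0 w0; pose P i : {poly K} := \sum_j w i 0 j *: 'X^j.
have P0 i : P i != 0.
  apply: contraNneq (w0 i) => Pi0; apply/eqP/rowP => j; rewrite mxE.
  have : (P i)`_j = 0 by rewrite Pi0 coef0.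
  rewrite coef_sum (bigD1 j) //= big1 => [|k kj].
    by rewrite coefZ coefXn eqxx mulr1 addr0.
  by rewrite coefZ coefXn eq_sym (inj_eq val_inj) (negPf kj) mulr0.
have /(nonroot_char0 char0)[t] : \prod_i P i != 0 by apply/prodf_neq0.
rewrite horner_prod => /prodf_neq0 Pt.
exists (\row_j t ^+ j) => i; have := Pt i isT.
rewrite horner_sum; congr (_ != 0); apply: eq_bigr => j _.
by rewrite mxE hornerZ hornerXn mulrC.
Qed.

Section Arrangement.
Variables (K : fieldType) (l n : nat).
Variables (H : 'I_n -> {vspace 'rV[K]_l}) (alpha : 'I_n -> {mpoly K[l]}).
Hypothesis hH : central_arrangement H.
Hypothesis halpha : forall i, defining_form (H i) (alpha i).

Lemma dim_hyperplane i : (\dim (H i)).+1 = l.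
Proof. exact: hH.2. Qed.

Lemma defining_form_neq0 i : alpha i != 0.
Proof.
apply/eqP => ai0; suff Hfull : H i = fullv.
  have := dim_hyperplane i; rewrite Hfull dimvf dim_matrix mul1r; lia.
apply: subv_anti; rewrite subvf; apply/subvP => v _; apply/(halpha i).2.
by rewrite ai0 meval0.
Qed.

Lemma hyperplane_diff i k : i != k -> exists2 v, v \in H i & v \notin H k.
Proof.
move=> ik; apply/subvPn; apply: contraNN ik => Hik.
apply/eqP/hH.1/eqP; rewrite eqEdim Hik /=.
by rewrite -ltnS !dim_hyperplane.
Qed.

Lemma hyperplane_cap i k : (2 < l)%N ->
  exists2 v, v \in (H i :&: H k)%VS & v != 0.
Proof.
move=> l_gt2; exists (vpick (H i :&: H k)%VS); first exact: memv_pick.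
rewrite vpick0 -dimv_eq0.
have := dimv_sum_cap (H i) (H k); have := dim_hyperplane i.
have := dim_hyperplane k; have := dimvS (subvf (H i + H k)%VS).
rewrite dimvf dim_matrix mul1r; lia.
Qed.

(** For [i != k] the form [a] is chosen so that [alpha k] does not belong to
    the ideal [(a, alpha i)]; the vector [v] witnesses this. *)
Lemma generic_form : [pchar K] =i pred0 -> (2 < l)%N -> (0 < n)%N ->
  exists a : {mpoly K[l]}, [/\ a \is 1.-homog, a != 0 &
    forall i k, i != k -> exists v : 'rV[K]_l,
      [/\ a.@[fun j => v 0 j] = 0, (alpha i).@[fun j => v 0 j] = 0
        & (alpha k).@[fun j => v 0 j] != 0]].
Proof.
move=> char0 l_gt2 n_gt0.
have /ClassicalEpsilon.choice[w wP] (ik : 'I_n * 'I_n) :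
    exists v, v \in (H ik.1 :&: H ik.2)%VS /\ v != 0.
  by have [v] := hyperplane_cap ik.1 ik.2 l_gt2; exists v.
have [c cw] := avoid_vectors char0 (fun ik => (wP ik).2).
pose L (v : 'rV[K]_l) := \sum_j c 0 j * v 0 j.
have LE (v : 'rV[K]_l) : (\sum_j c 0 j *: 'X_j).@[fun j => v 0 j] = L v.
  by rewrite raddf_sum; apply: eq_bigr => j _; rewrite /= mevalZ mevalXU.
exists (\sum_j c 0 j *: 'X_j); split.
- by apply: rpred_sum => j _; rewrite rpredZ // dhomogX /= mdeg1.
- have := cw (Ordinal n_gt0, Ordinal n_gt0); apply: contraNneq => a0.
  by apply/eqP; rewrite -[LHS]LE a0 meval0.
move=> i k ik; have [v0 v0i v0k] := hyperplane_diff ik.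
have /memv_capP[wi wk] := (wP (i, k)).1.
(* v0 is corrected along the intersection of H i and H k to be killed by a. *)
pose t := L v0 / L (w (i, k)).
exists (v0 - t *: w (i, k)); split.
- rewrite LE /L; under eq_bigr do rewrite !mxE mulrBr mulrCA.
  by rewrite sumrB -mulr_sumr divfK ?subrr // cw.
- by apply/(halpha i).2; rewrite rpredB ?rpredZ.
- apply/eqP => /(halpha k).2; rewrite rpredBr ?rpredZ //.
  exact/negP.
Qed.

Lemma jacobian_ideal_unit : (n <= 1)%N -> jacobian_ideal alpha 1.
Proof.
rewrite leq_eqVlt ltnS leqn0 => /orP[/eqP n1|/eqP n0]; last first.
  apply: ideal_gen_mem; rewrite inE /defining_poly big1 ?eqxx // => i _.
  by move: (ltn_ord i); lia.
have n_gt0 : (0 < n)%N by rewrite n1.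
pose i := Ordinal n_gt0.
have QE : defining_poly alpha = alpha i.
  rewrite /defining_poly (bigD1 i) //= big1 ?mulr1 // => k /eqP[].
  by apply: val_inj => /=; move: (ltn_ord k); lia.
have homi := (halpha i).1.
have [j aj0] := linear_form_coef_neq0 homi (defining_form_neq0 i).
apply/jacobian_idealP; exists 0, ((((alpha i)@_U_(j))^-1)%:MP *: delta_mx 0 j).
rewrite QE mul0r add0r der_applyZl der_apply_delta mderiv_linear //.
by rewrite -mpolyCM mulVf.
Qed.

End Arrangement.

(** * Monotonicity of the Hilbert function *)

(* hl2 leaves out exactly the arrangements of two or more lines in K^2: they
   are free, and (S/J)_0 = K while (S/J)_d = 0 for large d, so that the Hilbert
   function of S/J is not increasing. *)
Theorem theorem8p5 (K : fieldType) (char0 : [pchar K] =i pred0) (l n : nat)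
    (H : 'I_n -> {vspace 'rV[K]_l}) (alpha : 'I_n -> {mpoly K[l]})
    (hH : central_arrangement H)
    (halpha : forall i, defining_form (H i) (alpha i))
    (hfree : free_arrangement alpha)
    (hl2 : ~ (l = 2%N /\ (2 <= n)%N)) (i : nat) :
  (hilbert_function (jacobian_ideal alpha) i
     <= hilbert_function (jacobian_ideal alpha) i.+1)%N.
Proof.
have [n_le1|n_gt1] := leqP n 1.
  rewrite hilbert_function_unit //.
  by apply: jacobian_ideal_unit hH halpha n_le1.
pose i0 := Ordinal (ltnW n_gt1); pose i1 := Ordinal n_gt1.
(* For l = 1 the zero subspace is the only hyperplane. *)
have l_gt2 : (2 < l)%N.
  have := dim_hyperplane hH i0; have := dim_hyperplane hH i1.
  case: l H {alpha halpha hfree} hH hl2 => [|[|[|l']]] // H' hH' hl2'.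
    move=> /eqP; rewrite eqSS dimv_eq0 => /eqP H1 /eqP.
    by rewrite eqSS dimv_eq0 => /eqP; rewrite -H1 => /hH'.1/(congr1 val).
  by case: hl2'.
have homalpha k := (halpha k).1.
have [a [homa a0 aP]] := generic_form hH halpha char0 l_gt2 (ltnW n_gt1).
have [phi phiP homphi] := linear_form_residue homa a0.
have coprime j k : j != k -> ~ divides (phi (alpha j)) (phi (alpha k)).
  move=> jk /(residue_divides_lift _ _ phiP)[u [v akE]].
  have [x [ax ajx /eqP[]]] := aP _ _ jk.
  by rewrite akE mevalD !mevalM ax ajx !mul0r addr0.
have phi_neq0 k : phi (alpha k) != 0.
  have [j jk] : exists j, j != k.
    by have [->|] := eqVneq k i0; [exists i1 | rewrite eq_sym; exists i0].
  apply/eqP => phik0; apply: (coprime _ _ jk); exists 0.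
  by rewrite phik0 mulr0.
have phi_prime k : prime_elt (phi (alpha k)).
  have [psi psiP _] := linear_form_residue (homphi _ (homalpha k)) (phi_neq0 k).
  exact: residue_prime psiP.
apply: hilbert_function_nonzerodivisor homa _ => p.
exact: (nonzerodivisor_mod_jacobian homalpha phiP) (ltnW n_gt1) hfree.
Qed.
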